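(* Let $(X,d)$ and $(Y,\rho)$ be two complete metric spaces, and let $T:X\times Y\to X$ and $S:X\times Y\to Y$ be extended jointly $(\psi,\phi)$-contractions, where $\psi,\phi:(0,\infty)\to\mathbb{R}$. Suppose that the functions $\psi,\phi$ satisfy: (i) $\psi$ is nondecreasing; (ii) $\phi(t)<\psi(t)$ for every $t>0$; (iii) $\limsup_{t\to\epsilon+}\phi(t)<\psi(\epsilon+)$ for every $\epsilon>0$. Then there exists a unique point $\xi^*=(x^*,y^* )\in X\times Y$ such that $x^*=T(x^*,y^* )$ and $y^*=S(x^*,y^* )$, and the sequences $x_n=T^n(x,y)$ and $y_n=S^n(x,y)$ converge to $x^*$ and $y^*$ respectively for any $(x,y)\in X\times Y$.
   Context: Maps $T:X\times Y\to X$ and $S:X\times Y\to Y$ are extended jointly $(\psi,\phi)$-contractions, where $\psi,\phi:(0,\infty)\to\mathbb{R}$ are functions such that $\phi(t)<\psi(t)$ for every $t>0$, if for all $z=(x,y)$, $w=(u,v)$ in $X\times Y$ with $\max\{d(T(x,y),T(u,v)),\rho(S(x,y),S(u,v))\}>0$, both $\psi(d(Tz,Tw))\le\phi(\max\{d(x,u),\rho(y,v)\})$ and $\psi(\rho(Sz,Sw))\le\phi(\max\{d(x,u),\rho(y,v)\})$ hold. The iterates are defined by $T^1=T$, $S^1=S$, and for $n\ge2$, $T^n(x,y)=T\big(T^{n-1}(x,y),S^{n-1}(x,y)\big)$, $S^n(x,y)=S\big(T^{n-1}(x,y),S^{n-1}(x,y)\big)$. $\psi(\epsilon+)$ denotes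 the right-hand limit of $\psi$ at $\epsilon$. *)

(* Defs.v *)
From HB Require Import structures.
From mathcomp Require Import all_boot all_order all_algebra.
From mathcomp Require Import all_classical all_reals all_analysis.

Set Implicit Arguments.
Unset Strict Implicit.
Unset Printing Implicit Defensive.

Import Order.TTheory GRing.Theory Num.Theory.
Import numFieldNormedType.Exports.

Local Open Scope classical_set_scope.
Local Open Scope ring_scope.

(* As a [completeType] is pointed, a complete metric space is nonempty here;
   without this the existence of a fixed point fails. *)
#[short(type="completeMetricType")]
HB.structure Definition CompleteMetric (R : numDomainType) :=
  {M of Complete M & Metric R M}.

(* [psi] and [phi] stand for functions on the open half-line: they are total on
   [R], but nothing here depends on their values outside ]0, +oo[. In
   particular, when exactly one of the two image distances vanishes, the
   corresponding inequality involves psi(0), which is undefined; each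
   inequality is therefore required only when its image distance is positive. *)
Definition extended_jointly_contractions (R : realType) (X Y : metricType R)
    (psi phi : R -> R) (T : X * Y -> X) (S : X * Y -> Y) : Prop :=
  (forall t, 0 < t -> phi t < psi t) /\
  forall z w : X * Y,
    0 < Num.max (mdist (T z) (T w)) (mdist (S z) (S w)) ->
    (0 < mdist (T z) (T w) ->
       psi (mdist (T z) (T w))
         <= phi (Num.max (mdist z.1 w.1) (mdist z.2 w.2))) /\
    (0 < mdist (S z) (S w) ->
       psi (mdist (S z) (S w))
         <= phi (Num.max (mdist z.1 w.1) (mdist z.2 w.2))).

(* The pair (T^n z, S^n z), extended to n = 0 by z itself. *)
Fixpoint joint_iter (X Y : Type) (T : X * Y -> X) (S : X * Y -> Y)
    (n : nat) (z : X * Y) : X * Y :=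
  if n is m.+1 then
    (T (joint_iter T S m z), S (joint_iter T S m z))
  else z.

Definition Titer (X Y : Type) (T : X * Y -> X) (S : X * Y -> Y)
    (n : nat) (z : X * Y) : X := (joint_iter T S n z).1.

Definition Siter (X Y : Type) (T : X * Y -> X) (S : X * Y -> Y)
    (n : nat) (z : X * Y) : Y := (joint_iter T S n z).2.

(* Main.v *)
Require Import Defs.
From HB Require Import structures.
From mathcomp Require Import all_boot all_order all_algebra.
From mathcomp Require Import all_classical all_reals all_analysis.

Set Implicit Arguments.
Unset Strict Implicit.
Unset Printing Implicit Defensive.

Import Order.TTheory GRing.Theory Num.Theory.
Import numFieldNormedType.Exports.

Local Open Scope classical_set_scope.
Local Open Scope ring_scope.

(* For the max distance on X * Y, the map F = (T, S) satisfies
   psi (d (F z) (F w)) <= phi (d z w), hence it is contractive since phi < psi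
   and psi is nondecreasing. Moreover, psi is at least psi(e+) on ]e, +oo[ while
   phi stays below psi(e+) on some ]e, e + d[, so e < d z w < e + d forces
   d (F z) (F w) <= e. For contractive maps, this weak form of the Meir-Keeler
   condition suffices: it makes the distance between any two orbits tend to 0,
   and once a single step of an orbit is shorter than d, it keeps the rest of
   the orbit within e + d of its start, so that orbits are Cauchy. *)

Section prod_metric.
Context (R : realFieldType) (X Y : metricType R).

Definition prod_mdist (z w : X * Y) : R :=
  Num.max (mdist z.1 w.1) (mdist z.2 w.2).

Let prod_mdist_ge0 z w : 0 <= prod_mdist z w.
Proof. by rewrite /prod_mdist le_max mdist_ge0. Qed.

Let prod_mdist_positivity z w : prod_mdist z w = 0 -> z = w.
Proof.
case: z w => [x y] [u v] zw0.
have : prod_mdist (x, y) (u, v) <= 0 by rewrite zw0.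
rewrite /prod_mdist ge_max /= => /andP[xu yv].
by congr pair; apply: mdist_positivity; apply/eqP; rewrite eq_le mdist_ge0 andbT.
Qed.

(** A ball of the product is the product of the balls of its components, so the max distance is
    compatible with the product uniformity and its limits are componentwise. *)
Let prod_ballEmdist z e : ball z e = [set w | prod_mdist z w < e].
Proof.
apply/seteqP; split=> w; rewrite /ball/= /prod_ball !ballEmdist /prod_mdist gt_max.
  by case=> /= -> ->.
by move=> /andP[].
Qed.

HB.instance Definition _ := PseudoMetric_isMetric.Build R (X * Y)%type
  prod_mdist_ge0 prod_mdist_positivity prod_ballEmdist.

Lemma mdist_prodE (z w : X * Y) :
  mdist z w = Num.max (mdist z.1 w.1) (mdist z.2 w.2).
Proof. by []. Qed.

End prod_metric.

(* The library does not declare the joins of [Pointed] with the topological and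
   uniform structures on products; [cvg] on products needs them. *)
HB.saturate prod.

Section prod_complete.
Context (R : realFieldType) (X Y : completeMetricType R).

Let prod_cauchy_cvg (F : set_system (X * Y)) :
  ProperFilter F -> cauchy F -> cvg F.
Proof.
move=> PF /cauchyP Fc.
have /cauchy_cvg c1 : cauchy (fst @ F).
  apply/cauchyP => e e0; have [z Fz] := Fc e e0.
  by exists z.1; apply: (@filterS _ F _ (ball z e)) => // w [].
have /cauchy_cvg c2 : cauchy (snd @ F).
  apply/cauchyP => e e0; have [z Fz] := Fc e e0.
  by exists z.2; apply: (@filterS _ F _ (ball z e)) => // w [].
apply/cvg_ex; exists (lim (fst @ F), lim (snd @ F)).
have pairE : (fun z : X * Y => (z.1, z.2)) = id by apply/funext => -[].
by move=> A /(cvg_pair c1 c2); rewrite pairE.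
Qed.

HB.instance Definition _ := Uniform_isComplete.Build (X * Y)%type prod_cauchy_cvg.

End prod_complete.

Section weak_meir_keeler.
Context (R : realType) (M : completeMetricType R) (f : M -> M).
Context (contractive : forall x y, x != y -> mdist (f x) (f y) < mdist x y)
  (weak_mk : forall e, 0 < e -> exists2 d, 0 < d &
    forall x y, e < mdist x y < e + d -> mdist (f x) (f y) <= e).

Let nonexpansive x y : mdist (f x) (f y) <= mdist x y.
Proof.
have [->|/contractive/ltW//] := eqVneq x y.
by rewrite !mdistxx.
Qed.

(* If the infimum [l] of the distances were positive, the iterates would come
   within [l + d], hence within [l], hence strictly below [l]. *)
Lemma contractive_iter_dist_lt x y e : 0 < e ->
  exists n, mdist (iter n f x) (iter n f y) < e.
Proof.
move=> e0; pose u n := mdist (iter n f x) (iter n f y).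
have ubnd : has_inf (range u).
  split; first by exists (u 0%N), 0%N.
  by exists 0 => _ [n _ <-]; exact: mdist_ge0.
pose l := inf (range u).
have lu n : l <= u n by apply: ge_inf; [exact: ubnd.2|exists n].
have [l0|l0] := leP l 0.
  have [_ [n _ <-]] := inf_adherent e0 ubnd.
  by move=> un; exists n; apply: lt_le_trans un _; rewrite gerDr.
have [d d0 mk] := weak_mk l0.
have [_ [n _ <-] und] := inf_adherent d0 ubnd.
have unl : u n.+1 <= l.
  have := lu n; rewrite le_eqVlt => /predU1P[->|lun]; first exact: nonexpansive.
  by apply: mk; rewrite lun.
have : u n.+2 < u n.+1.
  apply: contractive; rewrite -mdist_gt0.
  exact: lt_le_trans (lu n.+1).
by move=> /lt_le_trans/(_ unl); rewrite ltNge lu.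
Qed.

(** The distances are nonincreasing in [n], so they stay below [e] once they get there. *)
Lemma contractive_iter_dist_cvg x y e : 0 < e ->
  \forall n \near \oo, mdist (iter n f x) (iter n f y) < e.
Proof.
move=> e0; have [N Ne] := contractive_iter_dist_lt x y e0.
exists N => // n /= /subnK <-; elim: (n - N)%N => [//|k ih].
by rewrite addSn; apply: le_lt_trans ih; exact: nonexpansive.
Qed.

Lemma weak_meir_keeler_iter_cvg x : cvg (iter n f x @[n --> \oo]).
Proof.
apply/cauchy_cvgP/cauchyP => e e0.
have e20 : 0 < e / 2 by rewrite divr_gt0.
have [d' d'0 mk] := weak_mk e20.
(* Capping [d] by [e / 2] makes the radius [e / 2 + d] at most [e]. *)
pose d := Num.min d' (e / 2).
have d0 : 0 < d by rewrite lt_min d'0.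
have [N Nd] := contractive_iter_dist_lt x (f x) d0.
exists (iter N f x); exists N => // n /= /subnK <-.
rewrite ballEmdist /= (splitr e).
suff : mdist (iter N f x) (iter (n - N + N) f x) < e / 2 + d.
  by move=> /lt_le_trans; apply; rewrite lerD2l ge_min lexx orbT.
elim: (n - N)%N => [|k ih]; first by rewrite mdistxx addr_gt0.
(* Going through [iter N.+1 f x] costs a first step shorter than [d]; what remains is the image
   under [f] of the previous distance, hence at most [e / 2]. *)
rewrite addSn (le_lt_trans (metric_triangle _ (iter N.+1 f x) _))//.
rewrite addrC ler_ltD//; last by rewrite iterS -iterSr in Nd *.
have [le_e2|gt_e2] := leP (mdist (iter N f x) (iter (k + N) f x)) (e / 2).
  exact: le_trans (nonexpansive _ _) le_e2.
apply: mk; rewrite gt_e2 (lt_le_trans ih)// lerD2l.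
by rewrite ge_min lexx.
Qed.

Theorem weak_meir_keeler_fixpoint :
  exists p, unique (fun x => x = f x) p /\
    forall x, iter n f x @[n --> \oo] --> p.
Proof.
pose p := lim (iter n f point @[n --> \oo]).
have pcvg : iter n f point @[n --> \oo] --> p by exact: weak_meir_keeler_iter_cvg.
have pfix : p = f p.
  apply/eqP; rewrite -[_ == _]negbK -mdist_gt0; apply/negP => pfp.
  (* For large [N], both [p] and [f p] are within half their distance of [iter N.+1 f point], the
     latter by nonexpansiveness. *)
  have e0 : 0 < mdist p (f p) / 2 by rewrite divr_gt0.
  have [N _ pN] := metricType_numDomainType.cvgr_dist_lt pcvg e0.
  have : mdist p (f p) < mdist p (f p).
    rewrite {2}(splitr (mdist p (f p))).
    apply: le_lt_trans (metric_triangle _ (iter N.+1 f point) _) _.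
    rewrite ltrD ?pN//= metric_sym (le_lt_trans (nonexpansive _ _))// pN//=.
  by rewrite ltxx.
have iterp n : iter n f p = p by elim: n => //= n ->.
exists p; split.
  split=> // q qfix; apply/eqP/negP => /negP /contractive.
  by rewrite -pfix -qfix ltxx.
(* The orbit of [p] is constant, and every other orbit approaches it. *)
move=> x; apply/metricType_numDomainType.cvgrPdist_lt => e e0.
have := contractive_iter_dist_cvg p x e0.
by apply: filterS => n; rewrite iterp.
Qed.

End weak_meir_keeler.

Section right_limits.
Context (R : realType) (psi phi : R -> R) (eps : R).

(** By monotonicity the right limit is the infimum of [psi] over ]eps, +oo[, where [psi eps] is a
    lower bound. *)
Lemma nondecreasing_lim_at_right_le s :
  0 < eps -> (forall s t : R, 0 < s -> s <= t -> psi s <= psi t) ->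
  eps < s -> lim (psi t @[t --> eps^'+]) <= psi s.
Proof.
move=> eps0 hpsi es.
have bnd : has_lbound (psi @` [set` Interval (BRight eps) (BInfty R false)]).
  exists (psi eps) => _ [t + <-]; rewrite /= in_itv/= andbT => et.
  exact/hpsi/ltW.
have nd : {in Interval (BRight eps) (BInfty R false) &,
    {homo psi : a b / a <= b}}.
  move=> a b; rewrite !in_itv/= !andbT => ea _.
  exact/hpsi/(lt_trans eps0).
rewrite (cvg_lim _ (nondecreasing_at_right_cvgr _ nd bnd))//.
by apply: ge_inf => //; exists s => //=; rewrite in_itv/= es.
Qed.

(** The upper limit is an infimum of suprema over right neighbourhoods, so one of these suprema is
    already below [l]. *)
Lemma limf_esup_at_right_lt l :
  (limf_esup (fun t : R => (phi t)%:E) eps^'+ < l%:E)%E ->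
  exists2 d, 0 < d & forall t, eps < t < eps + d -> phi t < l.
Proof.
move=> /ereal_inf_lt[_ [V [d /= d0 dV] <-] supV].
exists d => // t /andP[et td]; rewrite -lte_fin; apply: le_lt_trans supV.
apply: ereal_sup_ubound; exists t => //; apply: dV => //=.
by rewrite distrC gtr0_norm ?subr_gt0// ltrBlDl.
Qed.

End right_limits.

Theorem theorem3p1 (R : realType) (X Y : completeMetricType R)
    (psi phi : R -> R) (T : X * Y -> X) (S : X * Y -> Y)
    (hTS : extended_jointly_contractions psi phi T S)
    (hpsi : forall s t : R, 0 < s -> s <= t -> psi s <= psi t)
    (hlt : forall t : R, 0 < t -> phi t < psi t)
    (hlim : forall eps : R, 0 < eps ->
      (limf_esup (fun t : R => (phi t)%:E) eps^'+
         < (lim (psi t @[t --> eps^'+]))%:E)%E) :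
  exists xi : X * Y,
    unique (fun z : X * Y => z.1 = T z /\ z.2 = S z) xi /\
    forall z : X * Y,
      (Titer T S n z @[n --> \oo] --> xi.1) /\
      (Siter T S n z @[n --> \oo] --> xi.2).
Proof.
pose F z := (T z, S z).
have contrF z w : 0 < mdist (F z) (F w) ->
    psi (mdist (F z) (F w)) <= phi (mdist z w).
  (* The larger image distance equals the max, so it is positive and its own inequality applies. *)
  move=> F0; have [hT hS] := hTS.2 z w F0.
  move: F0; rewrite mdist_prodE /=.
  by case: (leP (mdist (T z) (T w))) => _.
have contractiveF z w : z != w -> mdist (F z) (F w) < mdist z w.
  rewrite -mdist_gt0 => zw0; rewrite ltNge; apply/negP => zwF.
  (* Otherwise [psi] at [mdist z w] would be at most [phi] there. *)
  have F0 := lt_le_trans zw0 zwF.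
  have := le_lt_trans (contrF _ _ F0) (hlt _ zw0).
  by rewrite ltNge hpsi.
have weak_mkF e : 0 < e -> exists2 d, 0 < d &
    forall z w, e < mdist z w < e + d -> mdist (F z) (F w) <= e.
  move=> e0; have [d d0 phid] := limf_esup_at_right_lt (hlim _ e0).
  exists d => // z w /phid phizw; rewrite leNgt; apply/negP => eF.
  have := nondecreasing_lim_at_right_le e0 hpsi eF.
  rewrite leNgt => /negP; apply; apply: le_lt_trans phizw.
  exact/contrF/(lt_trans e0).
have [xi [[xifix xiuniq] xicvg]] := weak_meir_keeler_fixpoint contractiveF weak_mkF.
exists xi; split.
  split; first by split; rewrite {1}xifix.
  by move=> z [z1 z2]; apply: xiuniq; rewrite [LHS]surjective_pairing z1 z2.
move=> z.
have iterF n : joint_iter T S n z = iter n F z by elim: n => //= n ->.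
rewrite /Titer /Siter.
under eq_fun do rewrite iterF.
under [X in _ /\ (X @ _ --> _)]eq_fun do rewrite iterF.
split; first exact: cvg_comp (xicvg z) cvg_fst.
exact: cvg_comp (xicvg z) cvg_snd.
Qed.
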